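(* There are infinitely many elementary equivalence classes of irreducible Artin groups of finite type.
   Context: Two groups are elementarily equivalent if they satisfy the same first-order sentences in the language of groups $(\cdot,{}^{-1},1)$. A Coxeter matrix is a symmetric $r\times r$ matrix $C=(m_{i,j})$ with $m_{i,i}=1$ and $m_{i,j}\in\{2,3,\ldots,\infty\}$ for $i\ne j$. Its Coxeter diagram is the labelled graph with vertices $x_1,\ldots,x_r$ and an edge labelled $m_{i,j}$ between $x_i$ and $x_j$ ($i\neq j$) exactly when $m_{i,j}\ge 3$. Writing $\langle x,y\rangle^m$ for the alternating product $xyx\cdots$ of length $m$ starting with $x$, the Artin group of $C$ is $\langle x_1,\ldots,x_r\mid \langle x_i,x_j\rangle^{m_{i,j}}=\langle x_j,x_i\rangle^{m_{i,j}}\text{ for } i\neq j\rangle$ (no relation when $m_{i,j}=\infty$). It is of finite type if the Coxeter group $\langle x_1,\ldots,x_r\mid (x_ix_j)^{m_{i,j}}=1,\ m_{i,j}\neq\infty\rangle$ is finite, and irreducible if the diagram is connected. *)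

(* Defs.v *)
From HB Require Import structures.
From mathcomp Require Import all_boot.
From mathcomp Require Import boolp classical_sets cardinality.

Set Implicit Arguments.
Unset Strict Implicit.
Unset Printing Implicit Defensive.

Local Open Scope group_scope.
Local Open Scope quotient_scope.
Local Open Scope classical_set_scope.

(** [term n] and [formula n] have their free variables among ['I_n]; a
    quantifier binds the variable [ord0] of its body and shifts the others. *)
Inductive term (n : nat) : Type :=
| Var of 'I_n
| One
| Inv of term n
| Mul of term n & term n.

Inductive formula : nat -> Type :=
| Equal n of term n & term n : formula n
| Not n of formula n : formula n
| And n of formula n & formula n : formula n
| Or n of formula n & formula n : formula n
| Implies n of formula n & formula n : formula n
| Forall n of formula n.+1 : formula n
| Exists n of formula n.+1 : formula n.

Definition sentence : Type := formula 0.

Section Semantics.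
Variable G : groupType.

Fixpoint eval n (e : 'I_n -> G) (t : term n) : G :=
  match t with
  | Var i => e i
  | One => 1
  | Inv t1 => (eval e t1)^-1
  | Mul t1 t2 => eval e t1 * eval e t2
  end.

Definition extend n (x : G) (e : 'I_n -> G) (i : 'I_n.+1) : G :=
  if unlift ord0 i is Some j then e j else x.

Fixpoint satisfies n (phi : formula n) : ('I_n -> G) -> Prop :=
  match phi in formula n return ('I_n -> G) -> Prop with
  | Equal _ t1 t2 => fun e => eval e t1 = eval e t2
  | Not _ p => fun e => ~ satisfies p e
  | And _ p q => fun e => satisfies p e /\ satisfies q e
  | Or _ p q => fun e => satisfies p e \/ satisfies q e
  | Implies _ p q => fun e => satisfies p e -> satisfies q e
  | Forall _ p => fun e => forall x : G, satisfies p (extend x e)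
  | Exists _ p => fun e => exists x : G, satisfies p (extend x e)
  end.

(** There is only one assignment ['I_0 -> G]. *)
Definition models (phi : sentence) : Prop := satisfies phi (fun=> 1).

End Semantics.

Definition elementarily_equivalent (G H : groupType) : Prop :=
  forall phi : sentence, models G phi <-> models H phi.

(** The letter [(x, false)] stands for [x], and [(x, true)] for [x^-1]. *)
Definition word (I : Type) : Type := seq (I * bool).

Definition word_inv (I : Type) (u : word I) : word I :=
  rev [seq (a.1, ~~ a.2) | a <- u].

Section Presentation.
Variables (I : choiceType) (R : word I -> word I -> Prop).

(** [R u v] means that [u = v] is one of the defining relations. *)
Inductive pres_eq : word I -> word I -> Prop :=
| pres_refl u : pres_eq u u
| pres_sym u v : pres_eq u v -> pres_eq v u
| pres_trans v u w : pres_eq u v -> pres_eq v w -> pres_eq u w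
| pres_cat u u' v v' :
    pres_eq u u' -> pres_eq v v' -> pres_eq (u ++ v) (u' ++ v')
| pres_cancel x b : pres_eq [:: (x, b); (x, ~~ b)] [::]
| pres_rel u v : R u v -> pres_eq u v.

Definition pres_eqb (u v : word I) : bool := `[< pres_eq u v >].

Lemma pres_eqb_refl : reflexive pres_eqb.
Proof. by move=> u; apply/asboolP; apply: pres_refl. Qed.

Lemma pres_eqb_sym : symmetric pres_eqb.
Proof. by move=> u v; apply/asboolP/asboolP => ?; apply: pres_sym. Qed.

Lemma pres_eqb_trans : transitive pres_eqb.
Proof.
by move=> v u w /asboolP uv /asboolP vw; apply/asboolP; apply: pres_trans vw.
Qed.

Canonical pres_equiv :=
  EquivRel pres_eqb pres_eqb_refl pres_eqb_sym pres_eqb_trans.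

Definition presented : Type := {eq_quot pres_equiv}.

HB.instance Definition _ := Choice.on presented.

Definition pres_class (u : word I) : presented := \pi_{eq_quot pres_equiv} u.
Definition pres_one : presented := pres_class [::].
Definition pres_inv (x : presented) : presented :=
  pres_class (word_inv (repr x)).
Definition pres_mul (x y : presented) : presented :=
  pres_class (repr x ++ repr y).

Lemma pres_classP u v : pres_class u = pres_class v <-> pres_eq u v.
Proof. by split=> [/eqquotP/asboolP | uv] //; apply/eqquotP/asboolP. Qed.

Lemma pres_class_repr x : pres_class (repr x) = x.
Proof. exact: reprK. Qed.

Lemma repr_pres_class u : pres_eq (repr (pres_class u)) u.
Proof. by apply/pres_classP; rewrite pres_class_repr. Qed.

Lemma pres_mulE u v :
  pres_mul (pres_class u) (pres_class v) = pres_class (u ++ v).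
Proof. by apply/pres_classP; apply: pres_cat; apply: repr_pres_class. Qed.

Lemma word_invK : involutive (@word_inv I).
Proof.
move=> u; rewrite /word_inv map_rev revK -map_comp -[RHS]map_id.
by apply: eq_map => -[x b] /=; rewrite negbK.
Qed.

Lemma pres_eq_mulV u : pres_eq (u ++ word_inv u) [::].
Proof.
elim: u => [|[x b] u IHu]; first exact: pres_refl.
have -> : ((x, b) :: u) ++ word_inv ((x, b) :: u) =
    [:: (x, b)] ++ (u ++ word_inv u) ++ [:: (x, ~~ b)].
  by rewrite /word_inv /= rev_cons -cats1 catA.
apply: pres_trans (pres_cancel x b).
apply: pres_cat (pres_refl _) (pres_cat IHu (pres_refl _)).
Qed.

Lemma pres_mulA : associative pres_mul.
Proof.
move=> x y z; rewrite -(pres_class_repr x) -(pres_class_repr y).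
by rewrite -(pres_class_repr z) !pres_mulE catA.
Qed.

Lemma pres_mul1 : left_id pres_one pres_mul.
Proof. by move=> x; rewrite -(pres_class_repr x) pres_mulE. Qed.

Lemma pres_mulr1 : right_id pres_one pres_mul.
Proof. by move=> x; rewrite -(pres_class_repr x) pres_mulE cats0. Qed.

Lemma pres_mulV : left_inverse pres_one pres_inv pres_mul.
Proof.
move=> x; rewrite -[X in pres_mul _ X]pres_class_repr pres_mulE.
apply/pres_classP; rewrite -[X in _ ++ X]word_invK.
exact: pres_eq_mulV.
Qed.

Lemma pres_mulrV : right_inverse pres_one pres_inv pres_mul.
Proof.
move=> x; rewrite -[X in pres_mul X _]pres_class_repr pres_mulE.
by apply/pres_classP; apply: pres_eq_mulV.
Qed.

HB.instance Definition _ := isGroup.Build presented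
  pres_mulA pres_mul1 pres_mulr1 pres_mulV pres_mulrV.

End Presentation.

(** [Some m] is the finite entry [m], and [None] is the entry [oo]. *)
Record coxeter_matrix : Type := CoxeterMatrix {
  rank : nat;
  entry : 'I_rank -> 'I_rank -> option nat;
  entry_sym : forall i j, entry i j = entry j i;
  entry_diag : forall i, entry i i = Some 1%N;
  entry_ge2 : forall i j m, i != j -> entry i j = Some m -> (2 <= m)%N
}.

Section CoxeterMatrixTheory.
Variable C : coxeter_matrix.

Definition diagram_edge : rel 'I_(rank C) := fun i j =>
  (i != j) && (if entry i j is Some m then 3 <= m else true)%N.

(** A connected diagram is required to be nonempty. *)
Definition irreducible : Prop :=
  (0 < rank C)%N /\ forall i j, connect diagram_edge i j.

(** The word [x_i x_j x_i ...] of length [m]. *)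
Definition alternating (i j : 'I_(rank C)) (m : nat) : word 'I_(rank C) :=
  mkseq (fun k => (if odd k then j else i, false)) m.

Definition artin_relation (u v : word 'I_(rank C)) : Prop :=
  exists i j m, [/\ i != j, entry i j = Some m,
    u = alternating i j m & v = alternating j i m].

Definition artin_group : groupType := presented artin_relation.

(** The case [i = j], where [m = 1], gives the relations [x_i ^ 2 = 1]. *)
Definition coxeter_relation (u v : word 'I_(rank C)) : Prop :=
  exists i j m, [/\ entry i j = Some m,
    u = flatten (nseq m [:: (i, false); (j, false)]) & v = [::]].

Definition coxeter_group : groupType := presented coxeter_relation.

Definition finite_type : Prop := finite_set [set: coxeter_group].

End CoxeterMatrixTheory.

(** Artin groups are represented by their Coxeter matrices, here and in
    [elementary_class]. *)
Definition irreducible_finite_type : set coxeter_matrix :=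
  [set C | irreducible C /\ finite_type C].

Definition elementary_class (C : coxeter_matrix) : set coxeter_matrix :=
  [set D | irreducible_finite_type D /\
           elementarily_equivalent (artin_group C) (artin_group D)].

(* Main.v *)
Require Import Defs.
From mathcomp Require Import all_boot.
From mathcomp Require Import boolp classical_sets cardinality.

(** The dihedral diagrams of label [2n] with [n >= 2] already give infinitely
    many classes.  Let [a] and [b] be the generators of the Artin group of
    such a diagram, and put [t = a b].  Its only relation says that [t ^ n]
    commutes with [a], so [t ^ n] is central
    ([rotation_power_central]).  The sentence [divisible_center N], saying that
    every central element is an [N]-th power, tells these groups apart.

    It holds for [N = n] ([center_power]), because every central element lies
    in [<t ^ n>].  To see this, let the group act on the free group on
    [a_0, ..., a_(n-1)], written as the set of reduced words: [t] shifts the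
    indices cyclically, and [a] multiplies on the left by [a_0].  This is the
    action on the cosets of [<t>], where the word
    [a_i1 ^ e1 a_i2 ^ e2 ...] is the coset of the product of the
    [t ^ i a ^ e t ^ -i] ([spell]).  Thus an element that fixes the empty word
    lies in [<t>] ([spell_gact]).  The empty word is the only fixed point of
    [t] ([shift_fixed]), and a central element permutes the fixed points of
    [t], so it fixes the empty word and is a power of [t].  As it also commutes
    with [a], it fixes the word [a_0], whose orbit under [t] has [n] elements;
    hence the exponent is a multiple of [n].

    It fails for [N > n] ([rotation_power_not_power]): the exponent sum of [b]
    modulo [N] maps every [N]-th power to [0], but maps the central element
    [t ^ n] to [n].

    So for [2 <= m < n] the group of label [2n] satisfies [divisible_center n]
    and the group of label [2m] does not.  The diagrams are connected, and the
    Coxeter group is a finite dihedral group, each element of which is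
    a rotation or the product of a rotation and a fixed reflection
    ([coxeter_normal_form]). *)

Set Implicit Arguments.
Unset Strict Implicit.
Unset Printing Implicit Defensive.

Local Open Scope group_scope.
Local Open Scope classical_set_scope.

(** * Presented groups and their actions *)

Lemma expg_mul_swap (H : groupType) (x y : H) m :
  x * (y * x) ^+ m = (x * y) ^+ m * x.
Proof.
elim: m => [|m IHm]; first by rewrite mulg1 mul1g.
by rewrite !expgSr mulgA IHm !mulgA.
Qed.

Section PresentedGroups.
Variables (I : choiceType) (R : word I -> word I -> Prop).

Definition generator (i : I) : presented R := pres_class R [:: (i, false)].

Lemma pres_class_cat u v :
  pres_class R (u ++ v) = pres_class R u * pres_class R v.
Proof. by rewrite -pres_mulE. Qed.

Lemma pres_class_letter i b :
  pres_class R [:: (i, b)] = if b then (generator i)^-1 else generator i.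
Proof.
case: b => //; apply/esym/mulg1_eq; rewrite -pres_class_cat.
by apply/pres_classP/(pres_cancel R i false).
Qed.

Lemma pres_class_cons l u :
  pres_class R (l :: u) = pres_class R [:: l] * pres_class R u.
Proof. by rewrite -pres_class_cat. Qed.

Lemma pres_class_nseq m i j :
  pres_class R (flatten (nseq m [:: (i, false); (j, false)])) =
  (generator i * generator j) ^+ m.
Proof.
elim: m => [|m IHm] //=.
by rewrite pres_class_cons [X in _ * X]pres_class_cons IHm expgS -mulgA.
Qed.

Lemma presented_ind (Q : presented R -> Prop) :
  Q 1 -> (forall i b u, Q (pres_class R u) -> Q (pres_class R ((i, b) :: u))) ->
  forall g, Q g.
Proof.
move=> Q1 Qcons g; rewrite -(pres_class_repr g).
by elim: (repr g) => [|[i b] u IHu] //; apply: Qcons.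
Qed.

(** By [act_cancel], the letters need to act by permutations only on the
    elements that satisfy [P]: the operations on words below are invertible on
    reduced words, but not on all words. *)
Record presented_action (X : Type) (P : X -> Prop)
    (act : I -> bool -> X -> X) : Prop := PresentedAction {
  act_stable : forall i b x, P x -> P (act i b x);
  act_cancel : forall i b x, P x -> act i b (act i (~~ b) x) = x;
  act_rel : forall u v x, R u v -> P x ->
    foldr (fun l => act l.1 l.2) x u = foldr (fun l => act l.1 l.2) x v
}.

Definition gact (X : Type) (act : I -> bool -> X -> X) (g : presented R) :
  X -> X := fun x => foldr (fun l => act l.1 l.2) x (repr g).

Section Action.
Variables (X : Type) (P : X -> Prop) (act : I -> bool -> X -> X).
Variable (actP : presented_action P act).

Lemma foldr_act_stable u x : P x -> P (foldr (fun l => act l.1 l.2) x u).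
Proof. by move=> Px; elim: u => //= l u; apply: (act_stable actP). Qed.

Lemma pres_eq_foldr u v : pres_eq R u v -> forall x, P x ->
  foldr (fun l => act l.1 l.2) x u = foldr (fun l => act l.1 l.2) x v.
Proof.
elim=> {u v}
  [|u v _ IH|v u w _ IHu _ IHw|u u' v v' _ IHu _ IHv|i b|u v Ruv] x Px //=.
- by rewrite IH.
- by rewrite IHu ?IHw.
- by rewrite !foldr_cat IHv ?IHu //; apply: foldr_act_stable.
- exact: (act_cancel actP).
- exact: (act_rel actP).
Qed.

Lemma gact_class u x : P x ->
  gact act (pres_class R u) x = foldr (fun l => act l.1 l.2) x u.
Proof. exact/pres_eq_foldr/repr_pres_class. Qed.

Lemma gact_stable g x : P x -> P (gact act g x).
Proof. exact: foldr_act_stable. Qed.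

Lemma gactM g h x : P x -> gact act (g * h) x = gact act g (gact act h x).
Proof.
move=> Px; rewrite -[g]pres_class_repr -[h]pres_class_repr -pres_class_cat.
by rewrite !gact_class ?foldr_cat //; apply: foldr_act_stable.
Qed.

Lemma gact_generator i x : P x -> gact act (generator i) x = act i false x.
Proof. exact: gact_class. Qed.

Lemma gactX g m x : P x -> gact act (g ^+ m) x = iter m (gact act g) x.
Proof.
move=> Px; elim: m => [|m IHm] /=; first by rewrite gact_class.
by rewrite expgS gactM ?IHm.
Qed.

End Action.
End PresentedGroups.

(** * Dihedral diagrams with an even label *)

Lemma ordS_iter n j (i : 'I_n) : iter j (@ordS n) i = (i + j) %% n :> nat.
Proof.
elim: j => [|j IHj] /=; first by rewrite addn0 modn_small.
by rewrite IHj -addn1 modnDml addn1 addnS.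
Qed.

Lemma ordS_iter_id n (i : 'I_n) : iter n (@ordS n) i = i.
Proof. by apply/val_inj; rewrite /= ordS_iter modnDr modn_small. Qed.

Section EvenDihedral.
(* The label is [2 (k + 2)]: label [2] would give a disconnected diagram. *)
Variable k : nat.
Notation n := k.+2.

Definition even_dihedral_entry (i j : 'I_2) : option nat :=
  Some (if i == j then 1 else n.*2)%N.

Lemma even_dihedral_sym i j :
  even_dihedral_entry i j = even_dihedral_entry j i.
Proof. by rewrite /even_dihedral_entry eq_sym. Qed.

Lemma even_dihedral_diag i : even_dihedral_entry i i = Some 1%N.
Proof. by rewrite /even_dihedral_entry eqxx. Qed.

Lemma even_dihedral_ge2 i j m :
  i != j -> even_dihedral_entry i j = Some m -> (2 <= m)%N.
Proof. by rewrite /even_dihedral_entry => /negPf-> [<-]. Qed.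

Definition even_dihedral : coxeter_matrix :=
  CoxeterMatrix even_dihedral_sym even_dihedral_diag even_dihedral_ge2.

Lemma even_dihedral_irreducible : irreducible even_dihedral.
Proof.
split=> // i j; have [->|ij] := eqVneq i j; first exact: connect0.
by apply: connect1; rewrite /diagram_edge ij /= /even_dihedral_entry (negPf ij).
Qed.

Notation i0 := (ord0 : 'I_2).
Notation i1 := (ord_max : 'I_2).

Lemma ord2_neq0 (i : 'I_2) : i != i0 -> i = i1.
Proof. by case: i => [[|[|]]] // ? _; apply: val_inj. Qed.

(** * The Coxeter group is finite *)

Section CoxeterGroup.
Notation W := (coxeter_group even_dihedral).
Let a : W := generator _ i0.
Let b : W := generator _ i1.
Let r : W := a * b.

Lemma coxeter_generator_sq i :
  (generator _ i : W) * generator _ i = 1.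
Proof.
rewrite -[RHS]/(pres_class _ [::]) -pres_class_cat.
apply/pres_classP/pres_rel.
by exists i, i, 1%N; rewrite entry_diag.
Qed.

Lemma coxeter_generatorV i : (generator _ i : W)^-1 = generator _ i.
Proof. exact/mulg1_eq/coxeter_generator_sq. Qed.

Lemma rotation_order : r ^+ n.*2 = 1.
Proof.
rewrite -pres_class_nseq; apply/pres_classP/pres_rel.
by exists i0, i1, n.*2.
Qed.

Lemma rotation_mod i : r ^+ i = r ^+ (i %% n.*2).
Proof.
by rewrite {1}(divn_eq i n.*2) expgnDr mulnC expgnA rotation_order expg1n mul1g.
Qed.

Lemma rotationV i : r ^- i = r ^+ (i * n.*2.-1).
Proof.
apply: mulg1_eq; rewrite -expgnDr -mulnS prednK ?double_gt0 //.
by rewrite mulnC expgnA rotation_order expg1n.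
Qed.

Lemma reflection_rotation i : a * r ^+ i = r ^- i * a.
Proof.
rewrite conjgCV conjXg -expVgn; congr (_ ^+ i * a).
rewrite conjgE invgM !coxeter_generatorV /r !mulgA.
by rewrite coxeter_generator_sq mul1g.
Qed.

(** Left multiplication by the involution [a] inverts the rotation and toggles
    the factor [a], and the other generator is [a r]; so these products are
    closed under left multiplication by generators. *)
Lemma coxeter_normal_form (g : W) : exists i (e : bool), g = r ^+ i * a ^+ e.
Proof.
have aS h : (exists i (e : bool), h = r ^+ i * a ^+ e) ->
    exists i (e : bool), a * h = r ^+ i * a ^+ e.
  move=> [i [e ->]]; exists (i * n.*2.-1)%N, (~~ e).
  rewrite mulgA reflection_rotation rotationV -mulgA; congr (_ * _).
  by case: e; rewrite /= ?mulg1 // coxeter_generator_sq.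
elim/presented_ind: g => [|i b' u [j [e IHu]]].
  by exists 0%N, false; rewrite mulg1.
rewrite pres_class_cons pres_class_letter coxeter_generatorV if_same.
have [->|/ord2_neq0->] := eqVneq i i0; first by apply: aS; exists j, e.
have -> : generator _ i1 = a * r :> W.
  by rewrite /r mulgA coxeter_generator_sq mul1g.
by rewrite -mulgA; apply: aS; exists j.+1, e; rewrite IHu expgS mulgA.
Qed.

Lemma even_dihedral_finite_type : finite_type even_dihedral.
Proof.
apply: (@sub_finite_set _ _
  [set r ^+ p.1 * a ^+ p.2 | p in [set: 'I_n.*2 * bool]]).
  move=> g _; have [i [e ->]] := coxeter_normal_form g.
  have lt_i : (i %% n.*2 < n.*2)%N by rewrite ltn_mod.
  by exists (Ordinal lt_i, e) => //=; rewrite -rotation_mod.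
exact/finite_image/finite_finset.
Qed.

End CoxeterGroup.

Lemma even_dihedral_irreducible_finite_type :
  irreducible_finite_type even_dihedral.
Proof.
by split; [apply: even_dihedral_irreducible|apply: even_dihedral_finite_type].
Qed.

(** * The relation of the Artin group *)

Notation G := (artin_group even_dihedral).
Let a : G := generator _ i0.
Let b : G := generator _ i1.
Let t : G := a * b.

Lemma alternating_double (i j : 'I_2) m :
  @alternating even_dihedral i j m.*2 =
  flatten (nseq m [:: (i, false); (j, false)]).
Proof.
elim: m => [|m IHm] //=; rewrite -IHm /alternating /mkseq doubleS /=.
congr [:: _, _ & _]; rewrite (iotaDl 2 0) -map_comp.
by apply: eq_map => x /=; rewrite negbK.
Qed.

Lemma artin_braid : (a * b) ^+ n = (b * a) ^+ n.
Proof.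
rewrite -!pres_class_nseq -!alternating_double.
by apply/pres_classP/pres_rel; exists i0, i1, n.*2.
Qed.

Lemma artin_action (X : Type) (P : X -> Prop) (act : 'I_2 -> bool -> X -> X) :
    (forall i c x, P x -> P (act i c x)) ->
    (forall i c x, P x -> act i c (act i (~~ c) x) = x) ->
    (forall x, P x -> iter n (act i0 false \o act i1 false) x =
                      iter n (act i1 false \o act i0 false) x) ->
  presented_action (@artin_relation even_dihedral) P act.
Proof.
move=> actP actK actR; split=> // u v x [i [j [m [ij Em -> ->]]]] Px.
have foldr_alt i' j' : foldr (fun l => act l.1 l.2) x
    (@alternating even_dihedral i' j' n.*2) =
    iter n (act i' false \o act j' false) x.
  by rewrite alternating_double; elim: (n) => //= p ->.
case: Em; rewrite (negPf ij) => <-; rewrite !foldr_alt.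
have [i_0|/ord2_neq0 i_1] := eqVneq i i0.
  rewrite i_0; have -> : j = i1 by apply: ord2_neq0; rewrite -i_0 eq_sym.
  exact: actR.
rewrite i_1; have [->|/ord2_neq0 j_1] := eqVneq j i0; first exact/esym/actR.
by rewrite i_1 j_1 eqxx in ij.
Qed.

Lemma braid_generator : b = a^-1 * t.
Proof. by rewrite mulKg. Qed.

(** The defining relation is [(a b) ^ n = (b a) ^ n], and
    [a (b a) ^ n = (a b) ^ n a] in every group. *)
Lemma rotation_power_commute_a : commute a (t ^+ n).
Proof.
by rewrite /commute -expg_mul_swap -artin_braid.
Qed.

Lemma rotation_power_central g : commute (t ^+ n) g.
Proof.
have ca := rotation_power_commute_a.
have cb : commute (t ^+ n) b.
  rewrite braid_generator; apply: commuteM.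
    by apply: commuteV; apply: commute_sym.
  exact/commute_sym/commuteX/commute_refl.
elim/presented_ind: g => [|i c u IHu]; first exact: commute1.
rewrite pres_class_cons pres_class_letter; apply: commuteM => //.
have ci : commute (t ^+ n) (generator _ i).
  by have [->|/ord2_neq0->] := eqVneq i i0; [apply: commute_sym|].
by case: c => //; apply: commuteV.
Qed.

(** * The action on reduced words *)

(** The letter [(i, false)] is the free generator [a_i], and [(i, true)] is its
    inverse, as for words in a presentation. *)
Definition cancelling (l l' : 'I_n * bool) := (l.1 == l'.1) && (l.2 != l'.2).

Definition reduced (x : word 'I_n) : bool :=
  sorted (fun l l' => ~~ cancelling l l') x.

(** On reduced words, this is left multiplication by the letter [(ord0, c)] in
    the free group. *)
Definition push (c : bool) (x : word 'I_n) : word 'I_n :=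
  if x is l :: x' then if cancelling (ord0, c) l then x' else (ord0, c) :: x
  else [:: (ord0, c)].

Definition shift (x : word 'I_n) : word 'I_n :=
  [seq (ordS l.1, l.2) | l <- x].

Definition unshift (x : word 'I_n) : word 'I_n :=
  [seq (ord_pred l.1, l.2) | l <- x].

Lemma shiftK : cancel shift unshift.
Proof.
move=> x; rewrite /shift /unshift -map_comp map_id_in // => -[i c] _ /=.
by rewrite ordSK.
Qed.

Lemma unshiftK : cancel unshift shift.
Proof.
move=> x; rewrite /shift /unshift -map_comp map_id_in // => -[i c] _ /=.
by rewrite ord_predK.
Qed.

Lemma reduced_shift x : reduced (shift x) = reduced x.
Proof.
rewrite /reduced /shift sorted_map; apply: eq_sorted => l l' /=.
by rewrite /cancelling /= (inj_eq (@ordS_inj _)).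
Qed.

Lemma reduced_unshift x : reduced (unshift x) = reduced x.
Proof. by rewrite -reduced_shift unshiftK. Qed.

Lemma reduced_push c x : reduced x -> reduced (push c x).
Proof.
case: x => //= l x; case: ifPn => [_|nc] red; first exact: path_sorted red.
by rewrite /reduced /= nc.
Qed.

Lemma pushK c x : reduced x -> push c (push (~~ c) x) = x.
Proof.
case: x => [|[i d] x] /=; first by case: c.
case: ifPn => [/andP[/= /eqP<- ncd]|_] red; last first.
  by case: c {red}.
have Edc : d = c by case: c d ncd {red} => [] [].
rewrite {}Edc {d ncd} in red *.
by case: x red => [|l x] //= /andP[/negPf->].
Qed.

(** The second generator is [b = a^-1 t], and [t] acts by [shift]. *)
Definition free_act (i : 'I_2) (c : bool) : word 'I_n -> word 'I_n :=
  if i == i0 then push c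
  else if c then unshift \o push false else push true \o shift.

Lemma shift_iter_id x : iter n shift x = x.
Proof.
have iterE m : iter m shift x = [seq (iter m (@ordS n) l.1, l.2) | l <- x].
  elim: m => [|m IHm] /=; first by rewrite map_id_in // => -[].
  by rewrite IHm /shift -map_comp.
by rewrite iterE map_id_in // => -[i c] _; rewrite ordS_iter_id.
Qed.

(** [t = a b] acts as [shift], and [b a = a^-1 t a] as a conjugate of it.
    The [n]-th power of both is the identity, so the relation holds. *)
Lemma free_action :
  presented_action (@artin_relation even_dihedral) reduced free_act.
Proof.
have red_iter m x : reduced (iter m shift x) = reduced x.
  by elim: m => //= m; rewrite reduced_shift.
apply: artin_action => [i c x rx|i c x rx|x rx].
- rewrite /free_act; case: ifP => _; first exact: reduced_push.
  case: c => /=; first by rewrite reduced_unshift reduced_push.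
  by rewrite reduced_push ?reduced_shift.
- rewrite /free_act; case: ifP => _; first exact: pushK.
  case: c => /=; first by rewrite (@pushK false) ?reduced_shift ?shiftK.
  by rewrite unshiftK (@pushK true).
have iter01 m :
    iter m (free_act i0 false \o free_act i1 false) x = iter m shift x.
  elim: m => //= m ->; rewrite /free_act /=.
  by rewrite (@pushK false) ?reduced_shift ?red_iter.
have iter10 m : iter m (free_act i1 false \o free_act i0 false) x =
    push true (iter m shift (push false x)).
  elim: m => [|m IHm]; first by rewrite (@pushK true).
  rewrite iterS IHm /free_act /= (@pushK false) //.
  by rewrite red_iter reduced_push.
by rewrite iter01 iter10 !shift_iter_id (@pushK true).
Qed.

(** The element of the Artin group that the free generator [a_i] stands for is
    [t ^ i a t ^ -i]. *)
Definition spell_letter (l : 'I_n * bool) : G :=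
  (if l.2 then a^-1 else a) ^ (t^-1 ^+ l.1).

Definition spell (x : word 'I_n) : G :=
  foldr (fun l g => spell_letter l * g) 1 x.

(** At the index [n.-1], which [ordS] sends to [0], this says that [t ^ n]
    commutes with [a]. *)
Lemma spell_letter_ordS i c :
  spell_letter (ordS i, c) = spell_letter (i, c) ^ t^-1.
Proof.
rewrite /spell_letter /= -conjgM -expgSr.
have [->|ne_i] := eqVneq i.+1 n; last first.
  by rewrite modn_small // ltn_neqAle ne_i ltn_ord.
rewrite modnn conjg1; apply/esym; rewrite expVgn conjgE invgK mulgA.
by rewrite rotation_power_central mulgK.
Qed.

Lemma spell_cons l x : spell (l :: x) = spell_letter l * spell x.
Proof. by []. Qed.

Lemma spell_shift x : spell (shift x) = spell x ^ t^-1.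
Proof.
elim: x => [|[i c] x IHx]; first by rewrite conj1g.
by rewrite !spell_cons conjMg -IHx spell_letter_ordS.
Qed.

Lemma spell_unshift x : spell (unshift x) = spell x ^ t.
Proof. by rewrite -{2}(unshiftK x) spell_shift conjgKV. Qed.

Lemma spell_push c x :
  spell (push c x) = (if c then a^-1 else a) * spell x.
Proof.
have spell0 d : spell_letter (ord0, d) = if d then a^-1 else a.
  exact: conjg1.
case: x => [|[i d] x]; first by rewrite /push spell_cons spell0.
rewrite /push; case: ifPn => [/andP[/eqP Ei ncd]|_].
  rewrite /= in Ei ncd; rewrite spell_cons -{}Ei spell0.
  by case: c d ncd => [] [] // _; rewrite ?mulVKg ?mulKg.
by rewrite spell_cons spell0.
Qed.

(** Membership in the subgroup generated by [t], with the exponent [i - j]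
    written as a pair of natural numbers. *)
Definition in_cyclic (h : G) : Prop := exists i j, h * t ^+ j = t ^+ i.

Lemma in_cyclicM h h' : in_cyclic h -> in_cyclic h' -> in_cyclic (h * h').
Proof.
move=> [i [j Eh]] [i' [j' Eh']]; exists (i + i')%N, (j' + j)%N.
by rewrite expgnDr mulgA -[h * _ * _]mulgA Eh' -mulgA -expgnDr addnC expgnDr
  mulgA Eh -expgnDr.
Qed.

(** Up to the right factor [h], [spell] turns the action on words into left
    multiplication: [spell x] represents the coset of [<t>] that corresponds to
    the reduced word [x]. *)
Lemma spell_free_act i c x : exists2 h, in_cyclic h &
  pres_class _ [:: (i, c)] * spell x = spell (free_act i c x) * h.
Proof.
rewrite pres_class_letter /free_act.
have [->|/ord2_neq0->] := eqVneq i i0.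
  by exists 1; rewrite ?spell_push ?mulg1 //; exists 0%N, 0%N; rewrite mulg1.
have -> : generator _ i1 = a^-1 * t by exact: braid_generator.
case: c => /=.
  exists t^-1; first by exists 0%N, 1%N; rewrite mulVg.
  by rewrite spell_unshift spell_push invgM invgK -mulgA [LHS]conjgCV invgK.
exists t; first by exists 1%N, 0%N; rewrite mulg1.
rewrite spell_push spell_shift -[LHS]mulgA -[RHS]mulgA; congr (_ * _).
exact: conjgCV.
Qed.

(** The group element [g] sends the empty word to the word of the coset
    [g <t>], so the stabilizer of the empty word is contained in [<t>]. *)
Lemma spell_gact g : exists2 h, in_cyclic h &
  g = spell (gact free_act g [::]) * h.
Proof.
elim/presented_ind: g => [|i c u [h Th IHu]].
  exists 1; first by exists 0%N, 0%N; rewrite mulg1.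
  by rewrite (gact_class free_action) // mulg1.
rewrite (gact_class free_action) // in IHu.
rewrite (gact_class free_action) //= pres_class_cons IHu mulgA.
have [h' Th' ->] := spell_free_act i c
  (foldr (fun l => free_act l.1 l.2) [::] u).
by exists (h' * h); [apply: in_cyclicM|rewrite mulgA].
Qed.

Lemma gact_rotation x : reduced x -> gact free_act t x = shift x.
Proof.
move=> rx; rewrite (gactM free_action) // !(gact_generator free_action) //.
  by rewrite /free_act /= (@pushK false) ?reduced_shift.
by rewrite /free_act /= reduced_push ?reduced_shift.
Qed.

Lemma gact_rotationX j i c :
  gact free_act (t ^+ j) [:: (i, c)] = [:: (iter j (@ordS n) i, c)].
Proof.
rewrite (gactX free_action) //.
by elim: j => //= j ->; rewrite gact_rotation.
Qed.

(** No index is fixed by the cyclic shift, since [n >= 2]. *)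
Lemma shift_fixed x : shift x = x -> x = [::].
Proof.
case: x => [|[i c] x] // [/(congr1 val) /= Ei _].
have := ltn_ord i; rewrite leq_eqVlt => /predU1P[Si|lt_i].
  by move: Ei; rewrite Si modnn => i_0; rewrite -i_0 in Si.
by rewrite modn_small // in Ei; move/eqP: Ei; rewrite eqn_leq ltnn.
Qed.

(** * The center *)

(** [z] maps the fixed point [[::]] of [t] to a fixed point of [t], and there
    is only one. *)
Lemma center_in_cyclic (z : G) : (forall g, commute z g) -> in_cyclic z.
Proof.
move=> Zz; have [h Th Ez] := spell_gact z.
suff z_fix : gact free_act z [::] = [::] by rewrite Ez z_fix mul1g.
have red_z : reduced (gact free_act z [::]) by apply: (gact_stable free_action).
apply: shift_fixed; rewrite -gact_rotation // -(gactM free_action) //.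
by rewrite -Zz (gactM free_action) // gact_rotation.
Qed.

(** If [z = t ^ (i - j)] commutes with [a], it fixes the word [a_0], the image
    of the empty word under [a].  So the index [0] does not move when shifted
    by [i - j], and [n] divides [i - j]. *)
Lemma center_power (z : G) : (forall g, commute z g) -> exists y, y ^+ n = z.
Proof.
move=> Zz; have [i [j Ez]] := center_in_cyclic Zz.
have z_fix : gact free_act z [::] = [::].
  have : gact free_act (z * t ^+ j) [::] = [::].
    rewrite Ez (gactX free_action) //; elim: i {Ez} => //= i ->.
    exact: gact_rotation.
  rewrite (gactM free_action) //.
  have -> // : gact free_act (t ^+ j) [::] = [::].
  rewrite (gactX free_action) //; elim: j {Ez} => //= j ->.
  exact: gact_rotation.
have a1 : gact free_act a [::] = [:: (ord0, false)].
  exact: (gact_generator free_action).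
have : gact free_act (t ^+ i * a) [::] = gact free_act (t ^+ j * a) [::].
  by rewrite -Ez -mulgA Zz (gactM free_action) // z_fix.
rewrite !(gactM free_action) // a1 !gact_rotationX => -[/(congr1 val)].
rewrite /= !ordS_iter !add0n => /eqP Eij.
case: (leqP j i) => [le_ji|/ltnW le_ij].
  move: Eij; rewrite eqn_mod_dvd // => /dvdnP[q Eq].
  by exists (t ^+ q); rewrite -expgnA -Eq expgnFr // -Ez mulgK.
move: Eij; rewrite eq_sym eqn_mod_dvd // => /dvdnP[q Eq].
exists (t ^- q); rewrite expVgn -expgnA -Eq expgnFr // -Ez invgM invgK.
by rewrite mulgK.
Qed.

(** * The exponent sum of the second generator *)

(** The group acts on the residues modulo [N] by adding the exponent sum of
    the second generator. *)
Definition count_act N (i : 'I_2) (c : bool) : 'I_N -> 'I_N :=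
  if i == i0 then id else if c then @ord_pred N else @ordS N.

Lemma count_action N :
  presented_action (@artin_relation even_dihedral) xpredT (@count_act N).
Proof.
apply: artin_action => // i c x _; rewrite /count_act.
by case: ifP => // _; case: c; rewrite /= ?ordSK ?ord_predK.
Qed.

Lemma count_act_iter N (g : G) :
  exists j, forall x, gact (@count_act N.+1) g x = iter j (@ordS N.+1) x.
Proof.
have actP := count_action N.+1.
elim/presented_ind: g => [|i c u [j IHu]].
  by exists 0%N => x; rewrite (gact_class actP).
have IHcons x :
    gact (@count_act N.+1) (pres_class _ ((i, c) :: u) : G) x =
    count_act i c (iter j (@ordS N.+1) x).
  by rewrite -IHu !(gact_class actP).
have [i_0|ne_i] := eqVneq i i0.
  by exists j => x; rewrite IHcons /count_act i_0 eqxx.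
exists ((if c then N else 1%N) + j)%N => x.
rewrite IHcons iterD /count_act (negPf ne_i); case: c {IHcons} => //.
by apply: (@ordS_inj N.+1); rewrite ord_predK -iterS ordS_iter_id.
Qed.

(** An [N]-th power shifts the residues modulo [N] by a multiple of [N], that
    is, trivially; but [t ^ n] shifts them by [n], and [0 < n < N]. *)
Lemma rotation_power_not_power N (y : G) : (n < N)%N -> y ^+ N <> t ^+ n.
Proof.
case: N => // N lt_nN Ey; have actP := count_action N.+1.
have [j Ej] := count_act_iter N y.
have y_id : gact (@count_act N.+1) (y ^+ N.+1) ord0 = ord0.
  rewrite (gactX actP) // (eq_iter Ej) -iterM; apply/val_inj.
  by rewrite /= ordS_iter add0n modnMr.
have t_S x : gact (@count_act N.+1) t x = ordS x.
  by rewrite (gactM actP) // !(gact_generator actP).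
have := congr1 (@nat_of_ord _) y_id; rewrite Ey (gactX actP) // (eq_iter t_S).
by rewrite ordS_iter add0n modn_small.
Qed.

End EvenDihedral.

(** * The separating sentences *)

Fixpoint power_term m (u : term m) (N : nat) : term m :=
  if N is N'.+1 then Mul u (power_term u N') else One m.

Lemma eval_power_term (H : groupType) m (e : 'I_m -> H) u N :
  eval e (power_term u N) = eval e u ^+ N.
Proof. by elim: N => //= N ->; rewrite expgS. Qed.

Definition divisible_center (N : nat) : sentence :=
  Forall (Defs.Implies
    (Forall (Equal (Mul (Var (lift ord0 ord0)) (Var ord0))
                   (Mul (Var ord0) (Var (lift ord0 ord0)))))
    (Exists (Equal (power_term (Var ord0) N) (Var (lift ord0 (@ord0 0)))))).

Lemma models_divisible_center (H : groupType) N :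
  models H (divisible_center N) <->
  forall z : H, (forall g, commute z g) -> exists y, y ^+ N = z.
Proof.
rewrite /models /=; split=> sat z Zz.
  have [|y] := sat z; last first.
    rewrite eval_power_term /= /extend unlift_none liftK unlift_none.
    by exists y.
  by move=> g; rewrite /extend unlift_none liftK unlift_none; apply: Zz.
have [g|y Ey] := sat z.
  by have := Zz g; rewrite /extend unlift_none liftK unlift_none.
by exists y; rewrite eval_power_term /= /extend unlift_none liftK unlift_none.
Qed.

Lemma even_dihedral_not_equivalent k l : (k < l)%N ->
  ~ elementarily_equivalent (artin_group (even_dihedral k))
                            (artin_group (even_dihedral l)).
Proof.
move=> lt_kl /(_ (divisible_center l.+2))[_].
have l_div : models (artin_group (even_dihedral l)) (divisible_center l.+2).
  exact/models_divisible_center/center_power.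
move=> /(_ l_div)/models_divisible_center k_div.
have [y] := k_div _ (@rotation_power_central k).
exact: rotation_power_not_power.
Qed.

Lemma elementary_class_inj :
  injective (fun k => elementary_class (even_dihedral k)).
Proof.
have sub k l : elementary_class (even_dihedral k) =
    elementary_class (even_dihedral l) -> (l <= k)%N.
  move=> Ekl; rewrite leqNgt; apply/negP => lt_kl.
  apply: (even_dihedral_not_equivalent lt_kl).
  suff [] : elementary_class (even_dihedral k) (even_dihedral l) by [].
  by rewrite Ekl; split=> //; apply: even_dihedral_irreducible_finite_type.
by move=> k l Ekl; apply/eqP; rewrite eqn_leq !sub.
Qed.

Theorem mainTheorem4 :
  infinite_set [set elementary_class C | C in irreducible_finite_type].
Proof.
have infinite_range :
    infinite_set (range (fun k => elementary_class (even_dihedral k))).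
  move=> fin; apply: infinite_nat; rewrite -(preimage_range
    (fun k => elementary_class (even_dihedral k))).
  by apply: finite_preimage fin => k l _ _; apply: elementary_class_inj.
apply: sub_infinite_set infinite_range => _ [k _ <-].
by exists (even_dihedral k) => //; apply: even_dihedral_irreducible_finite_type.
Qed.
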